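(* Let $j\ge\tfrac12$ be an integer or half-integer. Every spin coherent state is a minimum uncertainty state: for every spin coherent state $|\zeta\rangle$ of the spin-$j$ system, with $\rho=|\zeta\rangle\langle\zeta|$, there is an orthonormal basis $\boldsymbol n_1,\boldsymbol n_2,\boldsymbol n_3$ of $\mathbb R^3$ such that $$U(\rho,J_{\boldsymbol n_1})\,U(\rho,J_{\boldsymbol n_2})=\tfrac14\,|\operatorname{tr}\rho J_{\boldsymbol n_3}|^2 .$$ In particular, for $\rho=|j,j\rangle\langle j,j|$ one has $U(\rho,J_x)U(\rho,J_y)=\tfrac14|\operatorname{tr}\rho J_z|^2$.
   Context: Spin-$j$ system: $J_x,J_y,J_z$ are the Hermitian generators of the irreducible $(2j+1)$-dimensional representation of $\mathfrak{su}(2)$ on $\mathbb C^{2j+1}$, with $[J_x,J_y]=iJ_z$, $[J_y,J_z]=iJ_x$, $[J_z,J_x]=iJ_y$, and $J_\pm=J_x\pm iJ_y$. The Dicke states $|j,m\rangle$, $m=-j,\dots,j$, are the orthonormal basis with $J_z|j,m\rangle=m|j,m\rangle$, $J_+|j,m\rangle=\sqrt{(j-m)(j+m+1)}\,|j,m+1\rangle$, $J_-|j,m\rangle=\sqrt{(j+m)(j-m+1)}\,|j,m-1\rangle$. For a unit vector $\boldsymbol n$, $J_{\boldsymbol n}=n_xJ_x+n_yJ_y+n_zJ_z$. Spin coherent states are $|\zeta\rangle=e^{\tau J_+-\bar\tau J_-}|j,-j\rangle=(1+|\zeta|^2)^{-j}\sum_{m=-j}^j\sqrt{\binom{2j}{j+m}}\,\zeta^{j+m}|j,m\rangle$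 with $\tau=\frac\theta2e^{i\phi}$, $\zeta=\tan\frac\theta2\,e^{i\phi}$, $\theta\in[0,\pi]$, $\phi\in[0,2\pi]$ (for $\theta=\pi$ the state is $|j,j\rangle$ up to phase). For a density operator $\rho$ and Hermitian $X$, with $X_0=X-\operatorname{tr}(\rho X)$: $I(\rho,X)=\tfrac12\operatorname{tr}\big((i[\sqrt\rho,X_0])^2\big)$, $J(\rho,X)=\tfrac12\operatorname{tr}\big(\{\sqrt\rho,X_0\}^2\big)$, and $U(\rho,X)=\sqrt{I(\rho,X)J(\rho,X)}$, where $[A,B]=AB-BA$, $\{A,B\}=AB+BA$. *)

(* Defs.v *)
From HB Require Import structures.
From mathcomp Require Import all_boot all_order all_algebra.
From mathcomp Require Import sesquilinear spectral.
From mathcomp Require Import complex.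
From mathcomp Require Import all_classical all_reals all_analysis.

Set Implicit Arguments.
Unset Strict Implicit.
Unset Printing Implicit Defensive.

Import Order.TTheory GRing.Theory Num.Theory.
Import numFieldNormedType.Exports.

Local Open Scope classical_set_scope.
Local Open Scope ring_scope.
Local Open Scope sesquilinear_scope.

Section Matrices.
Variables (C : numClosedFieldType) (d : nat).

Definition expmx (A : 'M[C]_d.+1) : 'M[C]_d.+1 :=
  lim ((fun N : nat => \sum_(k < N) (k`!%:R)^-1 *: A ^+ k) @ \oo).

(* The functional calculus of z |-> sqrtC z through the spectral theorem:
   if A is positive semidefinite, sqrtmx A is its positive semidefinite square
   root. *)
Definition sqrtmx (A : 'M[C]_d.+1) : 'M[C]_d.+1 :=
  invmx (spectralmx A) *m diag_mx (map_mx sqrtC (spectral_diag A))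
    *m spectralmx A.

Definition mxcomm (A B : 'M[C]_d.+1) : 'M[C]_d.+1 := A *m B - B *m A.
Definition mxanticomm (A B : 'M[C]_d.+1) : 'M[C]_d.+1 := A *m B + B *m A.

Definition centered (rho X : 'M[C]_d.+1) : 'M[C]_d.+1 := X - (\tr (rho *m X))%:M.

Definition skew_info (rho X : 'M[C]_d.+1) : C :=
  2^-1 * \tr (('i *: mxcomm (sqrtmx rho) (centered rho X)) ^+ 2).

Definition dual_skew_info (rho X : 'M[C]_d.+1) : C :=
  2^-1 * \tr (mxanticomm (sqrtmx rho) (centered rho X) ^+ 2).

(* Both factors are nonnegative reals when rho is a density matrix and X is
   Hermitian; sqrtC is then the usual real square root. *)
Definition uncertainty (rho X : 'M[C]_d.+1) : C :=
  sqrtC (skew_info rho X * dual_skew_info rho X).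

Definition ketbra (psi : 'cV[C]_d.+1) : 'M[C]_d.+1 := psi *m psi ^t*.

End Matrices.

(* The spin is j = twoj / 2.  The index k of the standard basis of C^(2j+1)
   stands for the magnetic quantum number m = k - j, so that index 0 is m = -j
   and index 2j is m = j. *)
Section Spin.
Variables (R : realType) (twoj : nat).
Local Notation C := R[i].
Local Notation dim := twoj.+1.

Definition spin : C := twoj%:R / 2.

Definition magnetic (k : 'I_dim) : C := k%:R - spin.

Definition dicke (k : 'I_dim) : 'cV[C]_dim := delta_mx k 0.

Definition Jplus : 'M[C]_dim := \matrix_(a, b)
  if a == b.+1 :> nat
  then sqrtC ((spin - magnetic b) * (spin + magnetic b + 1)) else 0.

Definition Jminus : 'M[C]_dim := \matrix_(a, b)
  if b == a.+1 :> nat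
  then sqrtC ((spin + magnetic b) * (spin - magnetic b + 1)) else 0.

(* J+ = Jx + i Jy and J- = Jx - i Jy, solved for Jx and Jy *)
Definition Jx : 'M[C]_dim := 2^-1 *: (Jplus + Jminus).
Definition Jy : 'M[C]_dim := (2 * 'i)^-1 *: (Jplus - Jminus).
Definition Jz : 'M[C]_dim := diag_mx (\row_k magnetic k).

Definition Jdir (n : 'rV[R]_3) : 'M[C]_dim :=
  (n 0 0)%:C%C *: Jx + (n 0 1)%:C%C *: Jy + (n 0 2)%:C%C *: Jz.

(* exp(tau J+ - conj(tau) J-) |j,-j> with tau = theta/2 * e^(i phi).  The usual
   label is zeta = tan(theta/2) e^(i phi), which is infinite for theta = pi; the
   angles cover that case as well. *)
Definition coherent_state (theta phi : R) : 'cV[C]_dim :=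
  let tau : C := (theta / 2)%:C%C * (cos phi +i* sin phi)%C in
  expmx (tau *: Jplus - tau^* *: Jminus) *m dicke ord0.

Definition is_spin_coherent (psi : 'cV[C]_dim) : Prop :=
  exists theta phi : R,
    [/\ 0 <= theta <= pi, 0 <= phi <= 2 * pi & psi = coherent_state theta phi].

End Spin.

(* n 0, n 1, n 2 are orthonormal, hence a basis of R^3. *)
Definition orthonormal_basis (R : realType) (n : 'I_3 -> 'rV[R]_3) : Prop :=
  forall a b : 'I_3, \sum_(c < 3) n a 0 c * n b 0 c = (a == b)%:R.

Arguments Jx R twoj : clear implicits.
Arguments Jy R twoj : clear implicits.
Arguments Jz R twoj : clear implicits.
Arguments Jplus R twoj : clear implicits.
Arguments Jminus R twoj : clear implicits.
Arguments Jdir {R} twoj n.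
Arguments dicke R {twoj} k.

(* Main.v *)
Require Import Defs.
From mathcomp Require Import all_boot all_order all_algebra.
From mathcomp Require Import sesquilinear spectral.
From mathcomp Require Import complex.
From mathcomp Require Import ring.
From mathcomp Require Import all_classical all_reals all_analysis.
Import Order.TTheory GRing.Theory Num.Theory.
Import numFieldNormedType.Exports.
Local Open Scope classical_set_scope.
Local Open Scope ring_scope.
Local Open Scope sesquilinear_scope.
Set Implicit Arguments.
Unset Strict Implicit.
Unset Printing Implicit Defensive.

(** For a pure state both informations equal the variance, so the uncertainty of
    J_n is Var(J_n).  In the extreme states |j,-j> and |j,j> every component of
    the spin orthogonal to z has mean 0 and variance j/2, while J_z has mean -j
    or j: the equality reads (j/2)^2 = j^2/4.  A coherent state is E|j,-j> with
    E = exp(tau J+ - conj(tau) J-) unitary, and conjugation by E rotates the spin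
    components, so the equality is transported to the rotated frame.

    The rotation comes without differentiating: A = tau J+ - conj(tau) J- is
    skew-Hermitian and V = J_z +- i J_u (u orthogonal to z and to the rotation
    axis) is a ladder operator for it, A V = V (A +- i theta); in an eigenbasis
    of A this gives e^A V = e^(+- i theta) V e^A entry by entry. *)

(** * The exponential of a skew-Hermitian matrix *)

Lemma trmxC_mul (C : numClosedFieldType) (m n p : nat) (A : 'M[C]_(m, n))
    (B : 'M[C]_(n, p)) : (A *m B) ^t* = B ^t* *m A ^t*.
Proof. by rewrite trmx_mul map_mxM. Qed.

Lemma trmxCZ (C : numClosedFieldType) (m n : nat) (a : C) (X : 'M[C]_(m, n)) :
  (a *: X) ^t* = a^* *: X ^t*.
Proof. by rewrite linearZ /= map_mxZ. Qed.

Lemma trmxCB (C : numClosedFieldType) (m n : nat) (X Y : 'M[C]_(m, n)) :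
  (X - Y) ^t* = X ^t* - Y ^t*.
Proof. by rewrite linearB /= map_mxB. Qed.

(** Balls of matrices are entrywise, and the finitely many entries share a common tail. *)
Lemma cvg_mx_entries (K : numFieldType) (m n : nat)
    (u : nat -> 'M[K]_(m.+1, n.+1)) (L : 'M[K]_(m.+1, n.+1)) :
  (forall i j, (fun N => u N i j) @ \oo --> L i j) -> u @ \oo --> L.
Proof.
move=> cvu; apply/cvg_ballP => e e0.
have H : forall ij : 'I_m.+1 * 'I_n.+1,
    \forall N \near \oo, ball (L ij.1 ij.2) e (u N ij.1 ij.2).
  by move=> [i j]; move/cvg_ballP: (cvu i j); exact.
apply: filterS (filter_forall _ H) => N HN; split=> // i j; exact: (HN (i, j)).
Qed.

(** In an eigenbasis the powers of [A] are powers of its eigenvalues, so each entry of a partial sum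
    is a fixed linear combination of the scalar partial sums. Their limits enter as a hypothesis, so
    no exponential on [C] has to be at hand. *)
Lemma expmx_spectral (C : numClosedFieldType) (d : nat) (A : 'M[C]_d.+1)
    (e : 'rV[C]_d.+1) :
  A \is normalmx ->
  (forall i, (fun N : nat => \sum_(k < N) (k`!%:R)^-1 * spectral_diag A 0 i ^+ k)
     @ \oo --> e 0 i) ->
  expmx A = invmx (spectralmx A) *m diag_mx e *m spectralmx A.
Proof.
move=> nA cve; rewrite /expmx.
set S := spectralmx A; set D := spectral_diag A.
have US : S \in unitmx by exact: spectral_unit.
have powA k : A ^+ k = invmx S *m diag_mx (\row_i D 0 i ^+ k) *m S.
  elim: k => [|k IHk].
    rewrite expr0 (_ : diag_mx _ = 1%:M) ?mulmx1 ?mulVmx//.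
    by apply/matrixP => i j; rewrite !mxE expr0.
  rewrite exprSr IHk {1}(orthomx_spectralP nA) -/S -/D -mulmxE !mulmxA mulmxK //.
  congr (_ *m _); rewrite -!mulmxA; congr (_ *m _).
  by rewrite mulmx_diag; congr diag_mx; apply/rowP => i; rewrite !mxE exprSr.
apply: cvg_lim; first exact: norm_hausdorff.
apply: cvg_mx_entries => i j.
rewrite [X in X @ _ --> _](_ : _ = fun N => \sum_l (invmx S i l *
   (\sum_(k < N) (k`!%:R)^-1 * D 0 l ^+ k)) * S l j); last first.
  apply/funext => N; rewrite summxE.
  under eq_bigr => k _ do rewrite mxE powA mul_mx_diag mxE mulr_sumr.
  rewrite exchange_big; apply: eq_bigr => l _ /=.
  rewrite mulr_sumr mulr_suml; apply: eq_bigr => k _.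
  by rewrite !mxE; ring.
rewrite mul_mx_diag mxE; apply: cvg_big => [|l _]; first exact: add_continuous.
by rewrite mxE; apply: cvgMr_tmp; apply: cvgMl_tmp; exact: cve.
Qed.

(** The eigenvalues of an orthogonal projection are 0 and 1, and [sqrtC] fixes both. *)
Lemma sqrtmx_proj (C : numClosedFieldType) (d : nat) (P : 'M[C]_d.+1) :
  P ^t* = P -> P *m P = P -> sqrtmx P = P.
Proof.
move=> hP PP; have nP : P \is normalmx by apply/normalmxP; rewrite hP.
have US := spectral_unit P.
have EP := orthomx_spectralP nP.
rewrite {2}EP /sqrtmx; congr (_ *m diag_mx _ *m _).
have DE : diag_mx (spectral_diag P) = spectralmx P *m P *m invmx (spectralmx P).
  by rewrite [P in X in _ *m X *m _]EP !mulmxA mulmxV // mul1mx mulmxK.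
have : diag_mx (spectral_diag P) *m diag_mx (spectral_diag P) =
       diag_mx (spectral_diag P).
  by rewrite DE !mulmxA mulmxKV // -(mulmxA _ P P) PP.
rewrite mulmx_diag => /matrixP DD; apply/rowP => i; rewrite !mxE.
have := DD i i; rewrite !mxE eqxx !mulr1n => di.
have /orP[/eqP->|/eqP->] : (spectral_diag P 0 i == 0) || (spectral_diag P 0 i == 1).
- by rewrite -(subr_eq0 _ 1) -mulf_eq0 mulrBr mulr1 di subrr.
- by rewrite sqrtC0.
- by rewrite sqrtC1.
Qed.

Definition cis (R : realType) (y : R) : R[i] := (cos y +i* sin y)%C.

Lemma expi_coeff (R : realType) (y : R) (k : nat) :
  (k`!%:R)^-1 * (0 +i* y)%C ^+ k = (cos_coeff y k +i* sin_coeff y k)%C.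
Proof.
(* The parity indicators copy the shape of [cos_coeff] and [sin_coeff]. At [k = 0] the truncated
   [k.-1] is harmless, since its indicator vanishes. *)
have -> : (0 +i* y)%C ^+ k =
    (((~~ odd k)%:R * (-1) ^+ k./2 * y ^+ k) +i*
     ((odd k)%:R * (-1) ^+ k.-1./2 * y ^+ k))%C :> R[i].
  elim: k => [|k IHk]; first by rewrite !expr0 /= !mul1r !mul0r.
  rewrite exprS IHk /=; simpc.
  have [ok|ek] := boolP (odd k); rewrite ?ok /=; simpc; rewrite !exprS.
    have -> : uphalf k = k.-1./2.+1.
      by case: k ok {IHk} => //= k ok; rewrite uphalf_half.
    by rewrite ?mul0r ?mul1r exprS; congr (_ +i* _)%C; ring.
  by rewrite ?mul0r ?mul1r; congr (_ +i* _)%C; ring.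
rewrite (_ : (k`!%:R)^-1 = ((k`!%:R : R)^-1)%:C%C); last first.
  by rewrite fmorphV rmorph_nat.
rewrite /cos_coeff /sin_coeff /real_complex_def /=; simpc.
by congr (_ +i* _)%C; rewrite mulrC.
Qed.

Lemma cvg_expi (R : realType) (y : R) :
  let C : numClosedFieldType := R[i] in
  (fun N : nat => \sum_(k < N) (k`!%:R)^-1 * (0 +i* y)%C ^+ k : C) @ \oo -->
  (cis y : C).
Proof.
move=> C.
have cc : series (cos_coeff y) @ \oo --> cos y.
  by rewrite unlock; exact: is_cvg_series_cos_coeff.
have cs : series (sin_coeff y) @ \oo --> sin y.
  by rewrite unlock; exact: is_cvg_series_sin_coeff.
rewrite [X in X @ _ --> _](_ : _ = fun N =>
  (series (cos_coeff y) N +i* series (sin_coeff y) N)%C); last first.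
  apply/funext => N; rewrite /series /= !big_mkord.
  elim: N => [|N IHN]; first by rewrite !big_ord0.
  by rewrite !big_ord_recr /= IHN expi_coeff; simpc.
apply/cvgrPdist_lt => e e0.
(* The radius lives in [R[i]]; being positive it is real, so the real and the imaginary part can
   each be given half of it in [R]. *)
have /complex_realP[r re] : e \is Num.real by exact: gtr0_real.
have r2 : 0 < r / 2 by rewrite divr_gt0 // -ltcR -re.
have /cvgrPdist_lt/(_ _ r2) hc := cc.
have /cvgrPdist_lt/(_ _ r2) hs := cs.
near=> N.
have nc : `|cos y - series (cos_coeff y) N| < r / 2 by near: N.
have ns : `|sin y - series (sin_coeff y) N| < r / 2 by near: N.
rewrite /cis; set a := cos y - _ in nc; set b := sin y - _ in ns.
have -> : ((cos y +i* sin y) - (series (cos_coeff y) N +i* series (sin_coeff y) N))%C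
   = a%:C%C + (0 +i* b)%C by rewrite /real_complex_def; simpc.
apply: le_lt_trans (ler_normD _ _) _.
rewrite !normc_def /= !expr0n /= addr0 add0r !sqrtr_sqr -rmorphD re ltcR.
by rewrite (splitr r) ltrD.
Unshelve. all: by end_near. Qed.

Lemma cisD (R : realType) (x y : R) : cis (x + y) = cis x * cis y.
Proof.
by rewrite /cis cosD sinD; simpc; congr (_ +i* _)%C; ring.
Qed.

Lemma cis_conj (R : realType) (x : R) : (cis x)^* * cis x = 1.
Proof.
have E : (cis x)^* = (cos x -i* sin x)%C by [].
rewrite E /cis; simpc; rewrite -[RHS]/(1 +i* 0)%C -(cos2Dsin2 x).
by congr (_ +i* _)%C; ring.
Qed.

(** The eigenbasis is unitary, so the diagonal form is again skew-Hermitian: an eigenvalue is minus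
    its conjugate and has real part 0. *)
Lemma skew_spectral_diag (R : realType) (d : nat) (A : 'M[R[i]]_d.+1) i :
  A ^t* = - A -> spectral_diag A 0 i = (0 +i* complex.Im (spectral_diag A 0 i))%C.
Proof.
move=> skA; have nA : A \is normalmx by apply/normalmxP; rewrite skA mulmxN mulNmx.
have US := spectral_unit A.
have EA := orthomx_spectralP nA.
have DE : diag_mx (spectral_diag A) = spectralmx A *m A *m (spectralmx A) ^t*.
  rewrite -invmx_unitary ?spectral_unitarymx //.
  by rewrite [A in X in _ *m X *m _]EA !mulmxA mulmxV // mul1mx mulmxK.
have : (diag_mx (spectral_diag A)) ^t* = - diag_mx (spectral_diag A).
  by rewrite {1}DE !trmxC_mul trmxCK skA mulNmx mulmxN mulmxA -DE.
move=> /matrixP/(_ i i); rewrite !mxE eqxx !mulr1n.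
case: (spectral_diag A 0 i) => x y [] /= /eqP.
by rewrite -subr_eq0 opprK -mulr2n mulrn_eq0 => /eqP ->.
Qed.

Lemma expmx_skew (R : realType) (d : nat) (A : 'M[R[i]]_d.+1) :
  A ^t* = - A ->
  expmx A = invmx (spectralmx A)
    *m diag_mx (\row_i cis (complex.Im (spectral_diag A 0 i))) *m spectralmx A.
Proof.
move=> skA; apply: expmx_spectral => [|i].
  by apply/normalmxP; rewrite skA mulmxN mulNmx.
by rewrite mxE (skew_spectral_diag i skA); exact: cvg_expi.
Qed.

(** In a unitary eigenbasis the exponential is diagonal with entries of modulus 1. *)
Lemma expmx_skew_unitary (R : realType) (d : nat) (A : 'M[R[i]]_d.+1) :
  A ^t* = - A -> (expmx A) ^t* *m expmx A = 1%:M.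
Proof.
move=> skA; rewrite expmx_skew // invmx_unitary ?spectral_unitarymx //.
set S := spectralmx A; set D := diag_mx _.
have SS : S *m S ^t* = 1%:M by apply/unitarymxP; exact: spectral_unitarymx.
have S'S : S ^t* *m S = 1%:M.
  by rewrite -invmx_unitary ?spectral_unitarymx // mulVmx ?spectral_unit.
rewrite !trmxC_mul trmxCK -!mulmxA (mulmxA S) SS mul1mx (mulmxA _ D).
rewrite (_ : D ^t* *m D = 1%:M) ?mul1mx //.
rewrite tr_diag_mx map_diag_mx mulmx_diag.
by apply/matrixP => i j; rewrite !mxE cis_conj.
Qed.

(* In an eigenbasis of A the hypothesis reads (d_a - d_b - i y) V_ab = 0, so e^A
   shifts the same entries by the factor e^(i y). *)
Lemma expmx_skew_shift (R : realType) (d : nat) (A V : 'M[R[i]]_d.+1) (y : R) :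
  A ^t* = - A -> A *m V = V *m A + (0 +i* y)%C *: V ->
  expmx A *m V = cis y *: (V *m expmx A).
Proof.
move=> skA AV; rewrite expmx_skew //.
have nA : A \is normalmx by apply/normalmxP; rewrite skA mulmxN mulNmx.
have US := spectral_unit A.
have EA := orthomx_spectralP nA.
set S := spectralmx A in US EA *; set D := diag_mx _.
pose W := S *m V *m invmx S.
have SV : S *m V = W *m S by rewrite /W mulmxKV.
have VS : V *m invmx S = invmx S *m W by rewrite /W !mulmxA mulVmx // mul1mx.
have DW : diag_mx (spectral_diag A) *m W =
    W *m diag_mx (spectral_diag A) + (0 +i* y)%C *: W.
  have -> : diag_mx (spectral_diag A) = S *m A *m invmx S.
    by rewrite [A in X in _ *m X *m _]EA !mulmxA mulmxV // mul1mx mulmxK.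
  rewrite {1}/W !mulmxA mulmxKV // -(mulmxA S A) AV mulmxDr mulmxDl.
  by rewrite -scalemxAr -scalemxAl !mulmxA SV mulmxK.
clearbody W.
have DcW : D *m W = cis y *: (W *m D).
  rewrite /D mul_diag_mx mul_mx_diag; apply/matrixP => i j; rewrite !mxE.
  move/matrixP: DW => /(_ i j); rewrite mul_diag_mx mul_mx_diag !mxE.
  rewrite (skew_spectral_diag i skA) (skew_spectral_diag j skA) /=.
  move: (complex.Im _) (complex.Im _) => b a eW.
  have : ((0 +i* (a - (b + y)))%C : R[i]) * W i j = 0.
    have -> : ((0 +i* (a - (b + y)))%C : R[i]) = (0 +i* a)%C - (0 +i* b)%C - (0 +i* y)%C.
      by simpc; congr (_ +i* _)%C; ring.
    by rewrite !mulrBl eW; ring.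
  move/eqP; rewrite mulf_eq0 => /orP[/eqP[]/eqP|/eqP->]; last by rewrite !(mulr0,mul0r).
  by rewrite subr_eq0 => /eqP ->; rewrite cisD; ring.
rewrite -!mulmxA SV (mulmxA D) DcW -scalemxAl -scalemxAr; congr (_ *: _).
by rewrite (mulmxA V (invmx S)) VS -!mulmxA.
Qed.

(** * Pure states *)

Section PureState.
Variables (C : numClosedFieldType) (d : nat).
Implicit Types (psi : 'cV[C]_d.+1) (X Y E : 'M[C]_d.+1).

Definition expect psi X : C := (psi ^t* *m X *m psi) 0 0.

Lemma expectB psi X Y : expect psi (X - Y) = expect psi X - expect psi Y.
Proof. by rewrite /expect mulmxBr mulmxBl !mxE. Qed.

Lemma expectZ psi a X : expect psi (a *: X) = a * expect psi X.
Proof. by rewrite /expect -scalemxAr -scalemxAl !mxE. Qed.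

Lemma expect_scalar psi a : psi ^t* *m psi = 1%:M -> expect psi a%:M = a.
Proof.
by move=> n1; rewrite /expect mul_mx_scalar -scalemxAl n1 !mxE eqxx mulr1.
Qed.

Lemma tr_ketbra psi X : \tr (ketbra psi *m X) = expect psi X.
Proof.
by rewrite /ketbra -mulmxA mxtrace_mulC /mxtrace big_ord1.
Qed.

Lemma ketbra_sandwich psi X :
  ketbra psi *m X *m ketbra psi = expect psi X *: ketbra psi.
Proof.
have -> : ketbra psi *m X *m ketbra psi =
    psi *m (psi ^t* *m X *m psi) *m psi ^t* by rewrite /ketbra !mulmxA.
by rewrite [_ *m _ *m psi]mx11_scalar mul_mx_scalar -scalemxAl.
Qed.

Lemma sqrtmx_ketbra psi : psi ^t* *m psi = 1%:M -> sqrtmx (ketbra psi) = ketbra psi.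
Proof.
move=> n1; apply: sqrtmx_proj.
  by rewrite /ketbra trmxC_mul trmxCK.
by rewrite /ketbra mulmxA -(mulmxA psi) n1 mulmx1.
Qed.

(** A pure state is its own square root. The sign condition on [v] is what makes the final root of
    [v ^+ 2] equal to [v]. *)
Lemma uncertainty_pure psi X (v : C) :
  psi ^t* *m psi = 1%:M -> 0 <= v ->
  expect psi (X *m X) - expect psi X ^+ 2 = v ->
  uncertainty (ketbra psi) X = v.
Proof.
move=> n1 v0 varE; rewrite /uncertainty /skew_info /dual_skew_info.
rewrite sqrtmx_ketbra // /centered tr_ketbra.
set x := expect psi X; set Y := X - x%:M.
have Y0 : expect psi Y = 0 by rewrite expectB expect_scalar // subrr.
have YY : expect psi (Y *m Y) = v.
  rewrite -varE -/x /Y mulmxBl !mulmxBr mul_mx_scalar !mul_scalar_mx.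
  rewrite -mul_scalar_mx mul_scalar_mx !expectB !expectZ expect_scalar //.
  by rewrite -/x; ring.
clearbody Y.
set rho := ketbra psi.
have PP : rho *m rho = rho by rewrite /rho /ketbra mulmxA -(mulmxA psi) n1 mulmx1.
(* Y has mean 0, so the cross terms rho Y rho Y vanish in both squares. *)
have PYP : rho *m Y *m rho = 0 by rewrite ketbra_sandwich Y0 scale0r.
have T2 : \tr (Y *m rho *m (rho *m Y)) = v.
  by rewrite mulmxA -(mulmxA Y) PP -mulmxA mxtrace_mulC -mulmxA tr_ketbra.
have T1 : \tr (rho *m Y *m (Y *m rho)) = v by rewrite mxtrace_mulC T2.
have Z1 : rho *m Y *m (rho *m Y) = 0 by rewrite mulmxA PYP mul0mx.
have Z2 : Y *m rho *m (Y *m rho) = 0.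
  by rewrite mulmxA -(mulmxA Y rho Y) -(mulmxA Y _ rho) PYP mulmx0.
(* The square of 'i cancels the minus sign of the surviving commutator terms, so both traces become
   [v + v]. *)
rewrite exprZn sqrCi scaleN1r !expr2 -!mulmxE /mxcomm /mxanticomm.
rewrite mulmxBl mulmxDl !mulmxBr !mulmxDr Z1 Z2 !(sub0r, subr0, add0r, addr0).
rewrite !(raddfN, raddfB, raddfD) /= T1 T2.
rewrite -[RHS]sqrCK //; congr sqrtC; by field.
Qed.

(** The relation [X *m E = E *m Y] expresses conjugation by the unitary [E] without writing an
    inverse; all rotations below are stated in this form. *)
Lemma expect_intertwine psi E X Y :
  E ^t* *m E = 1%:M -> X *m E = E *m Y ->
  expect (E *m psi) X = expect psi Y.
Proof.
move=> EE XE; rewrite /expect trmxC_mul; congr (fun_of_matrix _ _ _).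
by rewrite -!mulmxA (mulmxA X) XE -(mulmxA E) (mulmxA (E ^t*)) EE mul1mx.
Qed.

End PureState.

(** * Rotations of the spin components *)

(** The half sum of the two ladder relations isolates [E *m Z], their difference isolates [E *m V].
    The scalars [C] and [S] will be the cosine and sine of the rotation angle. *)
Lemma rotation_of_ladder (F : numClosedFieldType) (d : nat)
    (E Z V : 'M[F]_d.+1) (C S : F) :
  E *m (Z + 'i *: V) = (C + 'i * S) *: ((Z + 'i *: V) *m E) ->
  E *m (Z + - 'i *: V) = (C - 'i * S) *: ((Z + - 'i *: V) *m E) ->
  (C *: Z - S *: V) *m E = E *m Z /\ (S *: Z + C *: V) *m E = E *m V.
Proof.
have i2 : ('i : F) * 'i = -1 by rewrite -expr2 sqrCi.
rewrite !mulmxDr !mulmxDl !mulNmx -!scalemxAl -!scalemxAr.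
move: (E *m Z) (E *m V) (Z *m E) (V *m E) => a b p q.
move=> /matrixP h1 /matrixP h2; split; apply/matrixP => k l;
  move: (h1 k l) (h2 k l); rewrite !mxE => h1' h2'.
  transitivity (((a k l + 'i * b k l) + (a k l + - 'i * b k l)) / 2); last by field.
  by rewrite h1' h2'; field: i2.
transitivity (((a k l + - 'i * b k l) - (a k l + 'i * b k l)) * 'i / 2); last first.
  by field: i2.
by rewrite h1' h2'; field: i2.
Qed.

(** * Matrix entries, commutation relations and variances of the spin operators *)

Section SpinAlgebra.
Variables (R : realType) (twoj : nat).
Local Notation C := R[i].
Local Notation dim := twoj.+1.
Local Notation Jp := (Jplus R twoj).
Local Notation Jm := (Jminus R twoj).
Local Notation J3 := (Jz R twoj).
Local Notation j := (spin R twoj).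

(** With the index b = j + m the radicand is a natural number, so it is visibly nonnegative; the
    subtraction does not truncate because b is at most 2j. *)
Lemma JplusE (a b : 'I_dim) :
  Jp a b = if a == b.+1 :> nat then sqrtC ((twoj - b) * b.+1)%:R else 0.
Proof.
rewrite mxE; case: eqP => // ab; congr sqrtC; rewrite /magnetic /spin.
rewrite natrM natrB ?leq_ord //.
by rewrite -natr1; field.
Qed.

Lemma JminusE (a b : 'I_dim) : Jm a b = Jp b a.
Proof.
rewrite JplusE mxE; case: eqP => // ab; congr sqrtC; rewrite /magnetic /spin.
rewrite natrM natrB ?leq_ord //.
by rewrite ab -natr1; field.
Qed.

Lemma trmxC_Jplus : Jp ^t* = Jm.
Proof.
apply/matrixP => a b; rewrite mxE JminusE [in LHS]mxE JplusE.
case: ifP => _; last by rewrite conjC0.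
by rewrite (CrealP (ger0_real _)) // sqrtC_ge0.
Qed.

Lemma trmxC_Jminus : Jm ^t* = Jp.
Proof. by rewrite -trmxC_Jplus trmxCK. Qed.

Lemma Jplus_Jminus (a b : 'I_dim) :
  (Jp *m Jm) a b = (a == b)%:R * (a%:R * (twoj%:R - a%:R + 1)).
Proof.
rewrite mxE; under eq_bigr do rewrite JminusE.
have [<-|nab] := eqVneq a b; last first.
  rewrite mul0r big1 // => l _; rewrite !JplusE.
  case: eqP => [al|_]; last by rewrite mul0r.
  case: eqP => [bl|_]; last by rewrite mulr0.
  by case/eqP: nab; apply/val_inj; rewrite /= al bl.
(* Only the index just below contributes. At the bottom there is none, in agreement with the factor
   [a%:R]. *)
rewrite mul1r; case: a => [[|a] ha] /=.
  by rewrite big1 ?mul0r // => l _; rewrite JplusE /= mul0r.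
have ha' : (a < dim)%N by exact: ltnW.
rewrite (bigD1 (Ordinal ha')) //= big1 => [|l]; last first.
  rewrite -val_eqE /= JplusE /= eqSS eq_sym => /negbTE ->; exact: mul0r.
rewrite addr0 JplusE /= eqxx -expr2 sqrtCK natrM natrB; last by rewrite ltnW.
by rewrite -natr1; ring.
Qed.

Lemma Jminus_Jplus (a b : 'I_dim) :
  (Jm *m Jp) a b = (a == b)%:R * ((twoj%:R - a%:R) * (a%:R + 1)).
Proof.
rewrite mxE; under eq_bigr do rewrite JminusE.
have [<-|nab] := eqVneq a b; last first.
  rewrite mul0r big1 // => l _; rewrite !JplusE.
  case: eqP => [la|_]; last by rewrite mul0r.
  case: eqP => [lb|_]; last by rewrite mulr0.
  by case/eqP: nab; apply/val_inj; move: lb; rewrite la => -[].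
(* Only the index just above contributes. At the top there is none, in agreement with the factor
   [twoj%:R - a%:R]. *)
rewrite mul1r; have [ha|] := ltnP a twoj.
  rewrite (bigD1 (Ordinal (ha : (a.+1 < dim)%N))) //= big1 => [|l]; last first.
    by rewrite -val_eqE /= JplusE => /negbTE ->; exact: mul0r.
  by rewrite addr0 JplusE /= eqxx -expr2 sqrtCK natrM natrB ?natr1 // ltnW.
have al := leq_ord a => la.
have -> : (a : nat) = twoj by apply/eqP; rewrite eqn_leq al.
rewrite subrr mul0r big1 // => l _; rewrite JplusE.
case: eqP => [E|_]; last by rewrite mul0r.
by have := leq_ord l; rewrite E leqNgt ltnS la.
Qed.

Lemma comm_Jplus_Jminus : Jp *m Jm = Jm *m Jp + 2 *: J3.
Proof.
apply/matrixP => a b; rewrite [RHS]mxE Jplus_Jminus Jminus_Jplus !mxE.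
rewrite mulrb /magnetic /spin; case: eqP => [_|_] /=; by field.
Qed.

Lemma comm_Jz_Jplus : J3 *m Jp = Jp *m J3 + Jp.
Proof.
apply/matrixP => a b; have := JplusE a b; move: Jp => P E.
rewrite mul_diag_mx mul_mx_diag !mxE E /magnetic.
case: eqP => [->|_]; last by rewrite !(mulr0, mul0r, addr0).
by rewrite -natr1; ring.
Qed.

Lemma comm_Jz_Jminus : J3 *m Jm = Jm *m J3 - Jm.
Proof.
apply/matrixP => a b; have := JminusE a b; rewrite JplusE; move: Jm => M E.
rewrite mul_diag_mx mul_mx_diag !mxE E /magnetic.
case: eqP => [->|_]; last by rewrite !(mulr0, mul0r, addr0, oppr0).
by rewrite -natr1; ring.
Qed.

(** For c = e^(i phi) this is the spin component along the horizontal unit vector (cos phi, - sin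
    phi, 0). The phase form keeps the ladder operators visible. *)
Definition Jtrans (c : C) : 'M[C]_dim := 2^-1 *: (c *: Jp + c^* *: Jm).

Lemma expect_dicke (k : 'I_dim) (X : 'M[C]_dim) : expect (dicke R k) X = X k k.
Proof.
rewrite /expect /dicke trmx_delta map_delta_mx -rowE.
by rewrite -colE !mxE.
Qed.

Lemma Jplus_diag (k : 'I_dim) : Jp k k = 0.
Proof. by rewrite JplusE; case: eqP => // /n_Sn. Qed.

Lemma Jtrans_diag (c : C) (k : 'I_dim) : Jtrans c k k = 0.
Proof.
have := JminusE k k; have := Jplus_diag k; rewrite /Jtrans.
move: Jp Jm => P M P0 M0.
by rewrite !mxE M0 P0 !mulr0 addr0 mulr0.
Qed.

Lemma Jplus2_diag (k : 'I_dim) : (Jp *m Jp) k k = 0.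
Proof.
rewrite mxE big1 // => l _; rewrite !JplusE.
case: eqP => [kl|_]; last by rewrite mul0r.
case: eqP => [lk|_]; last by rewrite mulr0.
by move: (leqnSn l); rewrite -kl leqNgt lk leqnn.
Qed.

Lemma Jminus2_diag (k : 'I_dim) : (Jm *m Jm) k k = 0.
Proof.
rewrite -[RHS](Jplus2_diag k) !mxE; apply: eq_bigr => l _.
by rewrite !JminusE mulrC.
Qed.

(** The squares of J+ and J- have no diagonal, so only (J+ J- + J- J+)/4 remains, with diagonal
    entry (j(j+1) - m^2)/2. The condition m^2 = j^2 covers both extreme states. *)
Lemma Jtrans_sq_extreme (c : C) (k : 'I_dim) : c^* * c = 1 ->
  magnetic R k ^+ 2 = j ^+ 2 -> (Jtrans c *m Jtrans c) k k = j / 2.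
Proof.
move=> c1 mk; rewrite /Jtrans -scalemxAl -scalemxAr mulmxDl !mulmxDr.
rewrite -!scalemxAl -!scalemxAr !scalerA.
have := Jplus2_diag k; have := Jminus2_diag k.
have := Jplus_Jminus k k; have := Jminus_Jplus k k.
move: (Jp *m Jm) (Jm *m Jp) (Jp *m Jp) (Jm *m Jm) => A B E F hB hA hF hE.
rewrite !mxE hA hB hE hF eqxx (mulrC c c^*) c1 !mulr0 addr0 add0r !mul1r.
have -> : (twoj%:R - k%:R) * (k%:R + 1) = j ^+ 2 + j - (magnetic R k ^+ 2 + magnetic R k) :> C.
  by rewrite /magnetic /spin; field.
have -> : k%:R * (twoj%:R - k%:R + 1) = j ^+ 2 + j - (magnetic R k ^+ 2 - magnetic R k) :> C.
  by rewrite /magnetic /spin; field.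
by rewrite mk; field.
Qed.

Lemma spin_ge0 : 0 <= j.
Proof. by rewrite /spin divr_ge0. Qed.

Lemma dicke_normalized (k : 'I_dim) : (dicke R k) ^t* *m dicke R k = 1%:M.
Proof.
rewrite /dicke trmx_delta map_delta_mx mul_delta_mx.
by apply/matrixP => a b; rewrite !ord1 !mxE.
Qed.

(** The unitary [E] will be the rotation for a coherent state and the identity for |j,j>. *)
Lemma uncertainty_Jtrans (E X : 'M[C]_dim) (c : C) (k : 'I_dim) :
  E ^t* *m E = 1%:M -> X *m E = E *m Jtrans c ->
  c^* * c = 1 -> magnetic R k ^+ 2 = j ^+ 2 ->
  uncertainty (ketbra (E *m dicke R k)) X = j / 2.
Proof.
move=> EE XE c1 mk; apply: uncertainty_pure.
- by rewrite trmxC_mul -mulmxA (mulmxA _ E) EE mul1mx dicke_normalized.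
- by rewrite divr_ge0 ?spin_ge0.
have XXE : X *m X *m E = E *m (Jtrans c *m Jtrans c).
  by rewrite -mulmxA XE !mulmxA XE.
rewrite (expect_intertwine _ EE XXE) (expect_intertwine _ EE XE) !expect_dicke.
by rewrite Jtrans_sq_extreme // Jtrans_diag expr0n subr0.
Qed.

Lemma tr_ketbra_Jz (E X : 'M[C]_dim) (k : 'I_dim) :
  E ^t* *m E = 1%:M -> X *m E = E *m J3 ->
  \tr (ketbra (E *m dicke R k) *m X) = magnetic R k.
Proof.
move=> EE XE.
by rewrite tr_ketbra (expect_intertwine _ EE XE) expect_dicke !mxE eqxx.
Qed.

(** * The rotation by the angle [y] that generates a coherent state *)

Section Rotation.
Variables (c : C) (y : R).
Hypothesis c1 : c^* * c = 1.

Let A : 'M[C]_dim := (y / 2)%:C%C *: (c *: Jp - c^* *: Jm).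

Lemma rotation_skew : A ^t* = - A.
Proof.
rewrite /A !(trmxCZ, trmxCB) conjCK trmxC_Jplus trmxC_Jminus.
rewrite -[RHS]scalerN opprB conj_Creal //.
by apply/complex_realP; exists (y / 2).
Qed.

(** With T = [Jtrans c] the commutators are [A, J3] = - y T and [A, T] = y J3, so J3 + i s T is an
    eigenvector of the commutator with A, for the eigenvalue i s y. *)
Lemma rotation_ladder (s : R) : s ^+ 2 = 1 ->
  A *m (J3 + (0 +i* s)%C *: Jtrans c) = (J3 + (0 +i* s)%C *: Jtrans c) *m A
  + (0 +i* (s * y))%C *: (J3 + (0 +i* s)%C *: Jtrans c).
Proof.
move=> s1; rewrite /A /Jtrans.
have := comm_Jplus_Jminus; have := comm_Jz_Jplus; have := comm_Jz_Jminus.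
rewrite -!scalemxAl -!scalemxAr !mulmxBl !mulmxBr !mulmxDl !mulmxDr.
rewrite -!scalemxAl -!scalemxAr !mulmxDl !mulmxDr.
rewrite -!scalemxAl -!scalemxAr => -> -> ->.
move: (Jp *m J3) (Jm *m J3) (Jp *m Jp) (Jm *m Jm) (Jm *m Jp) => X1 X2 X3 X4 X5.
move: Jp Jm J3 => P M Z.
have -> : (0 +i* s)%C = 'i * s%:C%C by rewrite -complexiE; simpc.
have -> : (0 +i* (s * y))%C = 'i * s%:C%C * y%:C%C by rewrite -complexiE; simpc.
have i2 : ('i : C) * 'i = -1 by rewrite -expr2 sqrCi.
have s2 : s%:C%C * s%:C%C = 1 by rewrite -rmorphM -expr2 s1.
have -> : (y / 2)%:C%C = y%:C%C / 2 by rewrite rmorphM fmorphV rmorph_nat.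
have t2 : 'i * s%:C%C * ('i * s%:C%C) = -1 :> C by rewrite mulrACA s2 i2 mulr1.
(* Both signs are handled at once: [t] stands for i s, and only t^2 = -1 is used of it. *)
move: ('i * s%:C%C) t2 => t t2; apply/matrixP => a b; rewrite !mxE.
by field: c1 t2.
Qed.

(** This is the component along the rotation axis: it and [A] are multiples of the same matrix c J+
    - conj(c) J-. *)
Lemma rotation_axis : A *m Jtrans (- 'i * c) = Jtrans (- 'i * c) *m A.
Proof.
rewrite (_ : Jtrans (- 'i * c) = (- 'i / 2) *: (c *: Jp - c^* *: Jm)).
  by rewrite /A -!scalemxAl -!scalemxAr scalerA mulrC -scalerA.
rewrite /Jtrans rmorphM rmorphN /= conjCi opprK -scalerA.
by move: Jp Jm => P M; apply/matrixP => a b; rewrite !mxE; ring.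
Qed.

(** Commuting with [A] is a ladder relation with shift 0, and [cis 0] is 1. *)
Lemma rotation_Jaxis :
  Jtrans (- 'i * c) *m expmx A = expmx A *m Jtrans (- 'i * c).
Proof.
have := @expmx_skew_shift _ _ A (Jtrans (- 'i * c)) 0 rotation_skew.
rewrite rotation_axis => ->; last by rewrite (_ : (0 *i)%C = 0) // scale0r addr0.
by rewrite /cis cos0 sin0 scale1r.
Qed.

(** The ladder relations for s = 1 and s = -1 give the factors e^(i y) and e^(- i y). Solving them
    shows that conjugation by the exponential rotates J3 and [Jtrans c] by the angle [y] in the
    plane they span. *)
Lemma rotation_expand :
  ((cos y)%:C%C *: J3 - (sin y)%:C%C *: Jtrans c) *m expmx A = expmx A *m J3 /\
  ((sin y)%:C%C *: J3 + (cos y)%:C%C *: Jtrans c) *m expmx A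
    = expmx A *m Jtrans c.
Proof.
have s1 : (1 : R) ^+ 2 = 1 by rewrite expr1n.
have s2 : (-1 : R) ^+ 2 = 1 by rewrite sqrrN expr1n.
have := expmx_skew_shift rotation_skew (rotation_ladder s1).
have := expmx_skew_shift rotation_skew (rotation_ladder s2).
rewrite !mul1r !mulN1r /cis cosN sinN.
have -> : (0 +i* 1)%C = 'i :> C by rewrite -complexiE.
have -> : (0 +i* -1)%C = - 'i :> C by rewrite -complexiE; simpc.
have -> : (cos y +i* sin y)%C = (cos y)%:C%C + 'i * (sin y)%:C%C.
  by rewrite -complexiE; simpc.
have -> : (cos y -i* sin y)%C = (cos y)%:C%C - 'i * (sin y)%:C%C.
  by rewrite -complexiE; simpc.
move=> h2 h1; move: (expmx A) J3 (Jtrans c) h1 h2 => E Z V h1 h2.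
exact: (@rotation_of_ladder C _ E Z V _ _ h1 h2).
Qed.

End Rotation.

Lemma Jtrans_polar (phi : R) : Jtrans (cis phi) =
  (cos phi)%:C%C *: Jx R twoj - (sin phi)%:C%C *: Jy R twoj.
Proof.
have i2 : ('i : C) * 'i = -1 by rewrite -expr2 sqrCi.
have ci : (2 * 'i)^-1 = - 'i / 2 :> C.
  rewrite invfM mulrC; congr (_ / _); apply: (mulfI (neq0Ci C)).
  by rewrite divff ?neq0Ci // mulrN i2 opprK.
have E : cis phi = (cos phi)%:C%C + 'i * (sin phi)%:C%C.
  by rewrite -complexiE /cis; simpc.
have E' : (cis phi)^* = (cos phi)%:C%C - 'i * (sin phi)%:C%C.
  have -> : (cis phi)^* = (cos phi -i* sin phi)%C by [].
  by rewrite -complexiE; simpc.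
rewrite /Jtrans /Jx /Jy E' E ci.
by move: Jp Jm => P M; apply/matrixP => a b; rewrite !mxE; ring.
Qed.

End SpinAlgebra.

(** * The rotated frame of a coherent state and the equality of uncertainties *)

Lemma coherent_stateE (R : realType) (twoj : nat) (theta phi : R) :
  coherent_state twoj theta phi =
  expmx ((theta / 2)%:C%C *: (cis phi *: Jplus R twoj
     - (cis phi)^* *: Jminus R twoj)) *m dicke R ord0.
Proof.
have r : (theta / 2)%:C%C^* = (theta / 2)%:C%C :> R[i].
  by rewrite conj_Creal //; apply/complex_realP; exists (theta / 2).
rewrite /coherent_state scalerBr !scalerA -[in RHS]r.
by rewrite -(rmorphM (@Num.conj R[i])) r.
Qed.

(** The rows are the rotated images of the horizontal direction of [Jtrans (cis phi)], of the
    rotation axis, which stays fixed, and of the z axis. The mean spin of the coherent state points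
    opposite to the last row. *)
Definition coherent_frame (R : realType) (theta phi : R) (a : 'I_3) : 'rV[R]_3 :=
  \row_b nth 0 (nth [::]
    [:: [:: cos theta * cos phi; - (cos theta * sin phi); sin theta];
        [:: sin phi; cos phi; 0];
        [:: - (sin theta * cos phi); sin theta * sin phi; cos theta]] a) b.

Lemma coherent_frame_orthonormal (R : realType) (theta phi : R) :
  orthonormal_basis (coherent_frame theta phi).
Proof.
have ht := cos2Dsin2 theta; have hp := cos2Dsin2 phi.
have st : sin theta ^+ 2 = 1 - cos theta ^+ 2 by rewrite -ht addrC addKr.
have sp : sin phi ^+ 2 = 1 - cos phi ^+ 2 by rewrite -hp addrC addKr.
case=> [[|[|[|//]]] ?] [[|[|[|//]]] ?]; rewrite !big_ord_recr big_ord0 /= !mxE /=;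
  move: (cos theta) (sin theta) (cos phi) (sin phi) st sp => C S c s st sp;
  rewrite -[RHS]/(_%:R : R) /=.
all: ring: st sp.
Qed.

(** It puts the rotation axis in polar form, so that [Jtrans_polar] and [cis_conj] apply to it. *)
Lemma mulNi_cis (R : realType) (phi : R) : - 'i * cis phi = cis (phi - pi / 2).
Proof.
rewrite /cis cosB sinB cos_pihalf sin_pihalf -complexiE.
by simpc; congr (_ +i* _)%C; ring.
Qed.

Lemma Jdir_coherent_frame (R : realType) (twoj : nat) (theta phi : R) :
  [/\ Jdir twoj (coherent_frame theta phi 0) = (sin theta)%:C%C *: Jz R twoj
        + (cos theta)%:C%C *: Jtrans twoj (cis phi),
      Jdir twoj (coherent_frame theta phi 1) = Jtrans twoj (- 'i * cis phi) &
      Jdir twoj (coherent_frame theta phi 2) = (cos theta)%:C%C *: Jz R twoj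
        - (sin theta)%:C%C *: Jtrans twoj (cis phi)].
Proof.
rewrite mulNi_cis !Jtrans_polar cosB sinB cos_pihalf sin_pihalf /Jdir !mxE /=.
move: (Jx R twoj) (Jy R twoj) (Jz R twoj) => X Y Z.
rewrite !(rmorphN, rmorphM, rmorphB, rmorphD, rmorph0, rmorph1) /=.
move: ((cos theta)%:C%C) ((sin theta)%:C%C) ((cos phi)%:C%C) ((sin phi)%:C%C) => C S c s.
split; apply/matrixP => k l; rewrite !mxE; ring.
Qed.

Theorem mainTheorem2 (R : realType) (twoj : nat) (twoj_gt0 : (0 < twoj)%N) :
  (forall psi : 'cV[R[i]]_twoj.+1, is_spin_coherent psi ->
     exists n : 'I_3 -> 'rV[R]_3,
       orthonormal_basis n /\
       uncertainty (ketbra psi) (Jdir twoj (n 0))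
         * uncertainty (ketbra psi) (Jdir twoj (n 1))
       = 4^-1 * `| \tr (ketbra psi *m Jdir twoj (n 2)) | ^+ 2)
  /\
  (let rho := ketbra (dicke R (ord_max : 'I_twoj.+1)) in
   uncertainty rho (Jx R twoj) * uncertainty rho (Jy R twoj)
   = 4^-1 * `| \tr (rho *m Jz R twoj) | ^+ 2).
Proof.
have m0 : magnetic R (ord0 : 'I_twoj.+1) = - spin R twoj by rewrite /magnetic sub0r.
have m1 : magnetic R (ord_max : 'I_twoj.+1) = spin R twoj.
  by rewrite /magnetic /spin /=; field.
split.
  move=> psi [theta [phi [_ _ ->]]].
  have c1 := cis_conj phi.
  exists (coherent_frame theta phi); split; first exact: coherent_frame_orthonormal.
  have [-> -> ->] := Jdir_coherent_frame twoj theta phi.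
  have [e3 e1] := rotation_expand twoj theta c1.
  have cN : (- 'i * cis phi)^* * (- 'i * cis phi) = 1 by rewrite mulNi_cis cis_conj.
  have uE := expmx_skew_unitary (rotation_skew twoj (cis phi) theta).
  have k0 : magnetic R (ord0 : 'I_twoj.+1) ^+ 2 = spin R twoj ^+ 2.
    by rewrite m0 sqrrN.
  rewrite coherent_stateE (uncertainty_Jtrans uE e1 c1 k0).
  rewrite (uncertainty_Jtrans uE (rotation_Jaxis _ _ _) cN k0).
  (* The mean along the last frame vector is -j, and (j/2)(j/2) = j^2/4. *)
  rewrite (tr_ketbra_Jz _ uE e3) m0 normrN ger0_norm ?spin_ge0 //.
  by field.
(* For |j,j> the same lemmas apply with the identity as rotation; Jx and Jy are the transverse
   components at the phases 0 and - pi/2. *)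
have u1 : (1%:M : 'M[R[i]]_twoj.+1) ^t* *m 1%:M = 1%:M.
  by rewrite mulmx1 trmx1 map_mx1.
have one (X : 'M[R[i]]_twoj.+1) : X *m 1%:M = 1%:M *m X by rewrite mulmx1 mul1mx.
have k1 : magnetic R (ord_max : 'I_twoj.+1) ^+ 2 = spin R twoj ^+ 2 by rewrite m1.
have xE : Jx R twoj = Jtrans twoj (cis 0).
  by rewrite Jtrans_polar cos0 sin0 scale1r scale0r subr0.
have yE : Jy R twoj = Jtrans twoj (cis (- (pi / 2))).
  rewrite Jtrans_polar cosN sinN cos_pihalf sin_pihalf rmorphN scaleNr opprK.
  by rewrite scale0r scale1r add0r.
have ud phi : uncertainty (ketbra (dicke R (ord_max : 'I_twoj.+1)))
    (Jtrans twoj (cis phi)) = spin R twoj / 2.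
  rewrite -[dicke R _]mul1mx.
  exact: (uncertainty_Jtrans u1 (one (Jtrans twoj (cis phi))) (cis_conj phi) k1).
have ux : uncertainty (ketbra (dicke R (ord_max : 'I_twoj.+1))) (Jx R twoj)
    = spin R twoj / 2 by rewrite xE ud.
have uy : uncertainty (ketbra (dicke R (ord_max : 'I_twoj.+1))) (Jy R twoj)
    = spin R twoj / 2 by rewrite yE ud.
rewrite /= ux uy -[dicke R _]mul1mx.
rewrite (tr_ketbra_Jz _ u1 (one _)) m1 ger0_norm ?spin_ge0 //.
by field.
Qed.
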